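(* Let $N_+,N_-\ge 1$ be integers, $N=N_++N_-$, let $k_1<k_2<\cdots<k_N$ be real numbers, $\theta_1^0,\dots,\theta_N^0\in\mathbb{R}$, and let $\theta_i(x,y)=-k_ix+k_i^2y+\theta_i^0$. Let $$\tau_{N_+}(x,y)=\sum_{1\le i_1<\cdots<i_{N_+}\le N}\Delta(i_1,\dots,i_{N_+})\,\exp\Big(\sum_{j=1}^{N_+}\theta_{i_j}(x,y)\Big),\qquad \Delta(i_1,\dots,i_{N_+})=\prod_{1\le j<l\le N_+}(k_{i_j}-k_{i_l})^2,$$ and let $w_1=-\frac{\partial}{\partial x}\log\tau_{N_+}$. Put $c_{i,j}=k_i+k_j$. Then $w_1$ has the following asymptotics as $y\to\pm\infty$. (i) As $y\to-\infty$ along $x=c_{i,N_++i}\,y+\xi$, for each $i=1,\dots,N_-$: $$w_1\longrightarrow\begin{cases}K_i(-,-):=\sum_{j=i+1}^{N_++i}k_j & \text{as }\xi\to-\infty,\\[2pt] K_i(+,-):=\sum_{j=i}^{N_++i-1}k_j & \text{as }\xi\to\infty.\end{cases}$$ (ii) As $y\to\infty$ along $x=c_{i,N_-+i}\,y+\xi$, for each $i=1,\dots,N_+$: $$w_1\longrightarrow\begin{cases}K_i(-,+):=\sum_{j=1}^{i-1}k_j+\sum_{j=1}^{N_+-i+1}k_{N-j+1} & \text{as }\xi\to-\infty,\\[2pt] K_i(+,+):=\sum_{j=1}^{i}k_j+\sum_{j=1}^{N_+-i}k_{N-j+1} & \text{as }\xi\to\infty.\end{cases}$$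
   Context: Empty sums are $0$ and empty products are $1$. The limits are iterated: for each fixed $\xi\in\mathbb{R}$ one first lets $y\to-\infty$ (resp. $y\to+\infty$) in $w_1(c\,y+\xi,\,y)$, with $c=c_{i,N_++i}$ (resp. $c=c_{i,N_-+i}$), obtaining a function of $\xi$; one then lets $\xi\to\pm\infty$. The time variable $t$ of the Kadomtsev–Petviashvili equation is held fixed and absorbed into the constants $\theta_i^0$. *)

(* Defs.v *)
From HB Require Import structures.
From mathcomp Require Import all_boot all_order all_algebra.
From mathcomp Require Import all_classical all_reals all_analysis.

Set Implicit Arguments.
Unset Strict Implicit.
Unset Printing Implicit Defensive.

Import Order.TTheory GRing.Theory Num.Theory.
Import numFieldNormedType.Exports.

Local Open Scope classical_set_scope.
Local Open Scope ring_scope.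

(* The parameters k_1, ..., k_N and theta^0_1, ..., theta^0_N are the values at
   1, ..., N of functions on nat; the other values are never used. *)

Definition theta (R : realType) (k theta0 : nat -> R) (i : nat) (x y : R) : R :=
  - k i * x + k i ^+ 2 * y + theta0 i.

Definition Delta (R : realType) (k : nat -> R) (p : nat) (s : 'I_p -> nat) : R :=
  \prod_(j < p) \prod_(l < p | (j < l)%N) (k (s j) - k (s l)) ^+ 2.

Definition increasing (p N : nat) (s : {ffun 'I_p -> 'I_N}) : bool :=
  [forall j : 'I_p, forall l : 'I_p, (j < l)%N ==> (s j < s l)%N].

(* The elements of 'I_N are 0, ..., N - 1, hence the shift in one_based. *)
Definition one_based (p N : nat) (s : {ffun 'I_p -> 'I_N}) (j : 'I_p) : nat :=
  (s j).+1.

Definition tau (R : realType) (N p : nat) (k theta0 : nat -> R) (x y : R) : R :=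
  \sum_(s : {ffun 'I_p -> 'I_N} | increasing s)
    Delta k (one_based s) *
    expR (\sum_(j < p) theta k theta0 (one_based s j) x y).

Definition w1 (R : realType) (N p : nat) (k theta0 : nat -> R) (x y : R) : R :=
  - derive1 (fun x' : R => ln (tau N p k theta0 x' y)) x.

Definition c (R : realType) (k : nat -> R) (i j : nat) : R := k i + k j.

(* K_i(a, b) is named K followed by the signs a (that of xi) and b (that of y),
   with m for - and p for +.  A sum over a <= j <= b is \sum_(a <= j < b.+1). *)

Definition Kmm (R : realType) (k : nat -> R) (Np i : nat) : R :=
  \sum_(i.+1 <= j < (Np + i).+1) k j.

Definition Kpm (R : realType) (k : nat -> R) (Np i : nat) : R :=
  \sum_(i <= j < (Np + i - 1).+1) k j.

Definition Kmp (R : realType) (k : nat -> R) (N Np i : nat) : R :=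
  \sum_(1 <= j < (i - 1).+1) k j +
  \sum_(1 <= j < (Np - i + 1).+1) k (N - j + 1)%N.

Definition Kpp (R : realType) (k : nat -> R) (N Np i : nat) : R :=
  \sum_(1 <= j < i.+1) k j + \sum_(1 <= j < (Np - i).+1) k (N - j + 1)%N.

(* Main.v *)
(* tau is a finite sum of positive exponentials, indexed by the subsets S of
   {1, ..., N} of size N_+, and w_1 is the average of sum_{j in S} k_j with the
   corresponding weights.  Along x = (k_a + k_b) y + xi the weight of S grows in y
   with rate sum_{j in S} (k_j - k_a) (k_j - k_b), up to a constant common to all S.
   This parabola is negative exactly for a < j < b, so as y -> -oo (b = a + N_+) the
   dominant S consist of the N_+ - 1 indices strictly between a and b together with
   a or b, and as y -> +oo (b = a + N_-) of the N_+ - 1 indices outside [a, b]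
   together with a or b.  Among the two dominant subsets the factor
   exp(- xi sum_{j in S} k_j) selects the one containing b as xi -> -oo and the one
   containing a as xi -> +oo. *)

Require Import Defs.
From HB Require Import structures.
From mathcomp Require Import all_boot all_order all_algebra.
From mathcomp Require Import all_classical all_reals all_analysis.
From mathcomp Require Import ring lra zify.
Import Order.TTheory GRing.Theory Num.Theory.
Import numFieldNormedType.Exports.
Local Open Scope classical_set_scope.
Local Open Scope ring_scope.

(** * Finite exponential sums and the limits of their quotients *)

Section ExponentialSums.
Context {R : realType} {T : finType}.
Implicit Types (P : pred T) (a m K : T -> R).

(** One form serves three variables: [tau] as a function of x, the parameter t along a line, and
    finally xi. *)
Definition expsum P a m (t : R) : R := \sum_(s | P s) a s * expR (m s * t).

Lemma is_derive_expsum P a m (t : R) :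
  is_derive t 1 (expsum P a m) (expsum P (fun s => m s * a s) m t).
Proof.
have -> : expsum P a m = \sum_(s | P s) (fun t => a s * expR (m s * t)).
  by apply/funext => x; rewrite fct_sumE.
rewrite /expsum; elim/big_ind2 : _ => [|f df g dg|s _].
- exact: is_derive_cst.
- exact: is_deriveD.
- have h : is_derive t 1 (fun t => m s * t) (m s).
    by apply: is_derive_eq; rewrite /GRing.scale /= mulr1.
  have h' := is_derive1_comp (is_derive_expR (m s * t)) h.
  rewrite (_ : (fun _ => _) = a s *: (expR \o (fun t => m s * t)))//.
  by apply: is_derive_eq; rewrite /GRing.scale /=; ring.
Qed.

Lemma sumr_gt0 P a : (forall s, P s -> 0 < a s) -> (exists s, P s) ->
  0 < \sum_(s | P s) a s.
Proof.
move=> a0 [s Ps]; rewrite (bigD1 s)//= ltr_pwDl ?a0// sumr_ge0// => i.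
by move=> /andP[/a0/ltW].
Qed.

Lemma cvg_expR_lt0 (m : R) : m < 0 -> expR (m * t) @[t --> +oo] --> 0.
Proof.
move=> m0.
have h : (- m) * t @[t --> +oo] --> +oo.
  by apply: gt0_cvgMry; [rewrite oppr_gt0|exact: cvg_id].
rewrite (_ : (fun _ => _) = (fun t => expR (- t)) \o (fun t => - m * t)).
  exact: cvg_comp h (@cvgr_expR R).
by apply/funext => t; rewrite /= mulNr opprK.
Qed.

(** After rescaling, each exponent is [(m s - M) * t] with [m s - M <= 0]: a term is constant in
    case of equality and decays otherwise. *)
Lemma cvg_expsum P a m (M : R) : (forall s, P s -> m s <= M) ->
  expsum P a m t * expR (- M * t) @[t --> +oo] -->
    \sum_(s | P s && (m s == M)) a s.
Proof.
move=> mM; rewrite big_mkcondr/=.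
have -> : (fun t => expsum P a m t * expR (- M * t)) =
          (fun t => \sum_(s | P s) a s * expR ((m s - M) * t)).
  apply/funext => t; rewrite /expsum mulr_suml; apply: eq_bigr => s _.
  by rewrite -mulrA -expRD mulrBl mulNr.
apply: (cvg_big (@add_continuous R)
  (Ff := fun s t => a s * expR ((m s - M) * t))
  (Fa := fun s => if m s == M then a s else 0)).
move=> s /mM; rewrite le_eqVlt => /predU1P[->|sM].
  rewrite eqxx subrr; under eq_fun do rewrite mul0r expR0 mulr1.
  exact: cvg_cst.
rewrite lt_eqF// -[X in _ --> X](mulr0 (a s)).
by apply: cvgMl_tmp; apply: cvg_expR_lt0; rewrite subr_lt0.
Qed.

(** Both sums are rescaled by the same [expR (- M * t)], which cancels in the quotient; positive
    coefficients keep the limiting denominator nonzero. *)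
Lemma cvg_expsum_ratio P a m K (M : R) :
    (forall s, P s -> 0 < a s) -> (forall s, P s -> m s <= M) ->
    (exists s, P s && (m s == M)) ->
  expsum P (fun s => a s * K s) m t / expsum P a m t @[t --> +oo] -->
  (\sum_(s | P s && (m s == M)) a s * K s) / (\sum_(s | P s && (m s == M)) a s).
Proof.
move=> a0 mM ex.
have S0 : 0 < \sum_(s | P s && (m s == M)) a s.
  by apply: sumr_gt0 => // s /andP[/a0].
have h := cvgM (cvg_expsum P (fun s => a s * K s) m M mM)
             (cvgV (lt0r_neq0 S0) (cvg_expsum P a m M mM)).
rewrite (_ : (fun _ => _) = (fun t => expsum P (fun s => a s * K s) m t *
  expR (- M * t) * (expsum P a m t * expR (- M * t))^-1)).
  exact: h.
apply/funext => t.
by rewrite -mulf_div divff ?mulr1// lt0r_neq0 ?expR_gt0.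
Qed.

Lemma cvg_expsum_ratio_cst P a m K (M L : R) :
    (forall s, P s -> 0 < a s) -> (forall s, P s -> m s <= M) ->
    (exists s, P s && (m s == M)) ->
    (forall s, P s -> m s = M -> K s = L) ->
  expsum P (fun s => a s * K s) m t / expsum P a m t @[t --> +oo] --> L.
Proof.
move=> a0 mM ex KL.
have S0 : 0 < \sum_(s | P s && (m s == M)) a s.
  by apply: sumr_gt0 => // s /andP[/a0].
have := cvg_expsum_ratio P a m K M a0 mM ex.
under [X in X / _]eq_bigr => s /andP[Ps /eqP ms] do rewrite (KL s Ps ms).
by rewrite -mulr_suml mulrAC divff ?mul1r// lt0r_neq0.
Qed.

End ExponentialSums.

(** * Subsets of given size with maximal sum *)

Section MaximalSubsets.
Context {R : realDomainType} {T : finType} (v : T -> R) (v0 : R) (D : {set T}).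
Hypothesis v_in : forall x, x \in D -> v0 < v x.
Hypothesis v_out : forall x, x \notin D -> v x <= v0.

(** Sum [v x - v0] instead of [v x]: the multiples of [v0] balance because S has one element more
    than D, and the common part of D and S cancels. *)
Lemma sum_excess (S : {set T}) : #|S| = #|D|.+1 ->
  \sum_(x in D) v x + v0 - \sum_(x in S) v x =
  \sum_(x in D :\: S) (v x - v0) + \sum_(x in S :\: D) (v0 - v x).
Proof.
move=> cS.
have sumB (A : {set T}) : \sum_(x in A) (v x - v0) = \sum_(x in A) v x - v0 *+ #|A|.
  by rewrite sumrB sumr_const.
have -> : \sum_(x in S :\: D) (v0 - v x) = - \sum_(x in S :\: D) (v x - v0).
  by rewrite -sumrN; apply: eq_bigr => x _; rewrite opprB.
have hD : \sum_(x in D) (v x - v0) =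
    \sum_(x in D :&: S) (v x - v0) + \sum_(x in D :\: S) (v x - v0).
  exact: big_setID.
have hS : \sum_(x in S) (v x - v0) =
    \sum_(x in S :&: D) (v x - v0) + \sum_(x in S :\: D) (v x - v0).
  exact: big_setID.
move: hD hS; rewrite /= !sumB [S :&: D]finset.setIC cS mulrS => hD hS.
lra.
Qed.

Lemma le_sum_excess (S : {set T}) : #|S| = #|D|.+1 ->
  \sum_(x in S) v x <= \sum_(x in D) v x + v0.
Proof.
move=> cS; rewrite -subr_ge0 sum_excess// addr_ge0// sumr_ge0// => x;
  rewrite inE subr_ge0 => /andP[xS xD]; first exact/ltW/v_in.
exact/v_out.
Qed.

(** Equality makes both nonnegative excess sums vanish. Strictness on D then forces D inside S, and
    the cardinality leaves exactly one further element, tied with [v0]. *)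
Lemma eq_sum_excess (S : {set T}) : #|S| = #|D|.+1 ->
  \sum_(x in S) v x = \sum_(x in D) v x + v0 ->
  exists x, [/\ x \notin D, v x = v0 & S = x |: D].
Proof.
move=> cS eS; have := sum_excess S cS; rewrite eS subrr => /esym/eqP.
have DS0 x : x \in D :\: S -> 0 <= v x - v0.
  by rewrite inE subr_ge0 => /andP[_ /v_in/ltW].
have SD0 x : x \in S :\: D -> 0 <= v0 - v x.
  by rewrite inE subr_ge0 => /andP[/v_out].
rewrite paddr_eq0 ?sumr_ge0// => /andP[/eqP DS /eqP SD].
have sDS : D \subset S.
  apply/fintype.subsetP => x xD; apply/negPn/negP => xS.
  have xDS : x \in D :\: S by rewrite inE xS.
  have := psumr_eq0P DS0 DS xDS => /eqP.
  by rewrite subr_eq0 gt_eqF// v_in.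
have /eqP/cards1P[x Sx] : #|S :\: D| = 1%N.
  by rewrite cardsD (finset.setIidPr sDS) cS subSnn.
have : x \in S :\: D by rewrite Sx set11.
move=> xSD; exists x; split.
- by move: xSD; rewrite inE => /andP[].
- by have := psumr_eq0P SD0 SD xSD => /eqP; rewrite subr_eq0 => /eqP.
- by rewrite -Sx -{1}(finset.setID S D) (finset.setIidPr sDS) finset.setUC.
Qed.

End MaximalSubsets.

(** * Increasing index maps as subsets *)

Section IncreasingMaps.
Context {p N : nat}.
Implicit Types (s : {ffun 'I_p -> 'I_N}) (S : {set 'I_N}).

Lemma increasingP s :
  reflect (forall j l : 'I_p, (j < l)%N -> (s j < s l)%N) (increasing s).
Proof.
by apply: (iffP 'forall_forallP) => h j l; [exact/implyP/h|exact/implyP/h].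
Qed.

Lemma increasing_inj s : increasing s -> injective s.
Proof.
move=> /increasingP h j l e; apply/val_inj/eqP => /=.
by case: ltngtP => // /h; rewrite e ltnn.
Qed.

Lemma card_increasing s : increasing s -> #|s @: [set: 'I_p]%SET| = p.
Proof. by move=> /increasing_inj h; rewrite card_imset// cardsT card_ord. Qed.

Lemma sum_increasing (V : nmodType) (F : 'I_N -> V) s : increasing s ->
  \sum_(j < p) F (s j) = \sum_(x in s @: [set: 'I_p]%SET) F x.
Proof.
move=> /increasing_inj h; rewrite big_imset /=; last by move=> ? ? _ _ /h.
by apply: eq_bigl => j; rewrite inE.
Qed.

(** Listing S in increasing order gives the map; every subset of size p thus indexes some term of
    [tau]. *)
Lemma increasing_image S : #|S| = p ->
  exists2 s, increasing s & s @: [set: 'I_p]%SET = S.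
Proof.
move=> Sp; have Sp' j : (j < p)%N -> (j < #|S|)%N by rewrite Sp.
pose s := [ffun j : 'I_p => enum_val (Ordinal (Sp' j (ltn_ord j)))].
(* The enumeration of S filters the increasing list of all ordinals, hence stays sorted. *)
have incS : sorted ltn (map val (enum S)).
  rewrite -[enum _](eq_filter (mem_enum _)).
  rewrite -(eq_filter (mem_map val_inj _)) -filter_map.
  by rewrite (sorted_filter ltn_trans)// -enumT val_enum_ord iota_ltn_sorted.
have inc : increasing s.
  apply/increasingP => j l jl; rewrite !ffunE.
  have hS (i : 'I_p) : (i < size (enum S))%N by rewrite -cardE Sp.
  rewrite !(enum_val_nth (s j)) /= -!(nth_map _ 0%N val)//.
  by rewrite (sorted_ltn_nth ltn_trans)// inE size_map.
exists s => //; apply/eqP; rewrite eqEcard card_increasing// Sp leqnn andbT.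
by apply/fintype.subsetP => _ /imsetP[j _ ->]; rewrite ffunE enum_valP.
Qed.

Lemma Delta_gt0 (R : realType) (k : nat -> R) s :
    (forall x y : 'I_N, (x < y)%N -> k x.+1 < k y.+1) -> increasing s ->
  0 < Delta k (one_based s).
Proof.
move=> hk /increasingP h; rewrite /Delta; apply: prodr_gt0 => j _.
apply: prodr_gt0 => l jl; rewrite exprn_even_gt0//= subr_eq0 lt_eqF//.
exact/hk/h.
Qed.

End IncreasingMaps.

(** * [tau] and [w1] as exponential sums in x *)

Section TauFunction.
Context {R : realType} {N p : nat} (k theta0 : nat -> R).
Hypothesis hk : forall x y : 'I_N, (x < y)%N -> k x.+1 < k y.+1.
Hypothesis hp : (p <= N)%N.
Implicit Types (s : {ffun 'I_p -> 'I_N}).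

Definition wavenumber s : R := \sum_(j < p) k (s j).+1.

(** The x-free factor of a term of [tau]; at y = 0 only [Delta] and the constants [theta0] remain in
    it. *)
Definition amplitude s (y : R) : R := Delta k (one_based s) *
  expR (\sum_(j < p) (k (s j).+1 ^+ 2 * y + theta0 (s j).+1)).

Lemma amplitude_gt0 s y : increasing s -> 0 < amplitude s y.
Proof. by move=> si; rewrite mulr_gt0 ?expR_gt0 ?Delta_gt0. Qed.

Lemma tau_expsum y : (fun x => tau N p k theta0 x y) =
  expsum (@increasing p N) (amplitude^~ y) (fun s => - wavenumber s).
Proof.
apply/funext => x; rewrite /tau /expsum; apply: eq_bigr => s _.
rewrite -mulrA -expRD /wavenumber mulNr mulr_suml -sumrN -big_split/=.
by congr (_ * expR _); apply: eq_bigr => j _; rewrite /theta /one_based; ring.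
Qed.

Lemma tau_gt0 x y : 0 < tau N p k theta0 x y.
Proof.
rewrite (congr1 (@^~ x) (tau_expsum y) : tau N p k theta0 x y = _).
apply: sumr_gt0 => [s si|].
  by rewrite mulr_gt0 ?expR_gt0// amplitude_gt0.
(* Since p <= N, the first p indices provide a term, so the sum is not empty. *)
have [s si _] : exists2 s, increasing s &
    s @: [set: 'I_p]%SET = [set x : 'I_N | (x < p)%N]%SET; last by exists s.
apply: increasing_image.
by rewrite -sum1dep_card -(big_ord_widen _ (fun=> 1%N) hp) sum1_card card_ord.
Qed.

(** The logarithmic derivative brings down the exponent [- wavenumber s], whose sign cancels the one
    in [w1]. *)
Lemma w1E x y : w1 N p k theta0 x y =
  expsum (@increasing p N) (fun s => amplitude s y * wavenumber s)
    (fun s => - wavenumber s) x /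
  expsum (@increasing p N) (amplitude^~ y) (fun s => - wavenumber s) x.
Proof.
have := tau_gt0 x y.
rewrite (congr1 (@^~ x) (tau_expsum y) : tau N p k theta0 x y = _) => t0.
rewrite /w1 (_ : (fun _ => _) = @ln R \o (fun x => tau N p k theta0 x y))//.
rewrite tau_expsum; have h := is_derive1_comp (is_derive1_ln t0) (is_derive_expsum _ _ _ x).
rewrite derive1E (@derive_val _ _ _ _ _ _ _ h) mulrC -mulNr; congr (_ / _).
by rewrite /expsum -sumrN; apply: eq_bigr => s _; ring.
Qed.

End TauFunction.

(** * The iterated limit along a line, for abstract D, a and b *)

Section Asymptotics.
Context {R : realType} {N p : nat} (k theta0 : nat -> R).
Hypothesis hk : forall x y : 'I_N, (x < y)%N -> k x.+1 < k y.+1.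
Variables (D : {set 'I_N}) (a b : 'I_N) (sg cc : R).

(* sg is the sign of y, so that both limits become t --> +oo with y = sg * t. *)
Let v (x : 'I_N) : R := sg * (k x.+1 ^+ 2 - cc * k x.+1).

Hypothesis ab : (a < b)%N.
Hypothesis aD : a \notin D.
Hypothesis bD : b \notin D.
(** For nonzero [sg] this forces [cc] to be k_a + k_b, the slope at which exchanging a for b leaves
    the growth rate unchanged. *)
Hypothesis vab : v a = v b.
Hypothesis v_in : forall x, x \in D -> v a < v x.
Hypothesis v_out : forall x, x \notin D -> x != a -> x != b -> v x < v a.
Hypothesis cardD : #|D|.+1 = p.

Local Notation inc := (@increasing p N).

Let v_out_le x : x \notin D -> v x <= v a.
Proof.
move=> xD; have [->//|xa] := eqVneq x a; have [->|xb] := eqVneq x b.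
  by rewrite -vab.
exact/ltW/v_out.
Qed.

Let rate (s : {ffun 'I_p -> 'I_N}) : R := \sum_(j < p) v (s j).
Let top : R := \sum_(x in D) v x + v a.
Let dominant : pred {ffun 'I_p -> 'I_N} := fun s => inc s && (rate s == top).

Lemma rate_le s : inc s -> rate s <= top.
Proof.
move=> si; rewrite /rate (sum_increasing _ v)//.
by apply: le_sum_excess => //; rewrite card_increasing.
Qed.

(** A maximal index set is D with one element tied with a, and only a and b are tied outside D. *)
Lemma dominant_wavenumber s : dominant s ->
  wavenumber k s = \sum_(x in D) k x.+1 + k a.+1 \/
  wavenumber k s = \sum_(x in D) k x.+1 + k b.+1.
Proof.
move=> /andP[si /eqP]; rewrite /rate (sum_increasing _ v)// => e.
have cS : #|s @: [set: 'I_p]%SET| = #|D|.+1 by rewrite card_increasing.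
have [x [xD xv Sx]] := eq_sum_excess v _ D v_in v_out_le _ cS e.
rewrite /wavenumber (sum_increasing _ (fun x : 'I_N => k x.+1))// Sx.
rewrite big_setU1//= [k x.+1 + _]addrC.
have [->|xa] := eqVneq x a; first by left.
have [->|xb] := eqVneq x b; first by right.
by have := v_out x xD xa xb; rewrite xv ltxx.
Qed.

Lemma exists_dominant x : x \notin D -> v x = v a ->
  exists2 s, dominant s & wavenumber k s = \sum_(x in D) k x.+1 + k x.+1.
Proof.
move=> xD xv; have [|s si sx] := @increasing_image p N (x |: D).
  by rewrite cardsU1 xD add1n.
exists s.
  rewrite /dominant si /= /rate (sum_increasing _ v)// sx big_setU1//= xv.
  by rewrite addrC.
by rewrite /wavenumber (sum_increasing _ (fun x : 'I_N => k x.+1))// sx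
  big_setU1//= addrC.
Qed.

(** On the line, each phase is [v] times t, minus k xi, plus a constant. For fixed xi the xi-part
    joins the coefficients of an exponential sum in t. *)
Lemma w1_line xi t :
  w1 N p k theta0 (cc * (sg * t) + xi) (sg * t) =
  expsum inc (fun s => amplitude k theta0 s 0 * expR (- wavenumber k s * xi) *
                         wavenumber k s) rate t /
  expsum inc (fun s => amplitude k theta0 s 0 * expR (- wavenumber k s * xi))
    rate t.
Proof.
have pN : (p <= N)%N.
  by have := max_card (mem (a |: D)); rewrite cardsU1 aD add1n cardD card_ord.
rewrite w1E//.
have E s : amplitude k theta0 s (sg * t) *
    expR (- wavenumber k s * (cc * (sg * t) + xi)) =
  amplitude k theta0 s 0 * expR (- wavenumber k s * xi) * expR (rate s * t).
  rewrite /amplitude -!mulrA -!expRD; congr (_ * expR _).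
  rewrite /wavenumber /rate !mulNr !mulr_suml -!sumrN -!big_split/=.
  by apply: eq_bigr => j _; rewrite /v; ring.
congr (_ / _); apply: eq_bigr => s _; last exact: E.
by rewrite mulrAC E mulrAC.
Qed.

(** The quotient limit is applied twice: in t with exponents [rate], then in xi to the surviving
    [dominant] terms with exponents given by [wavenumber]. *)
Lemma w1_asymptotics : exists f : R -> R,
  [/\ forall xi, w1 N p k theta0 (cc * (sg * t) + xi) (sg * t)
        @[t --> +oo] --> f xi,
      f xi @[xi --> -oo] --> \sum_(x in D) k x.+1 + k b.+1
    & f xi @[xi --> +oo] --> \sum_(x in D) k x.+1 + k a.+1].
Proof.
pose A (s : {ffun 'I_p -> 'I_N}) := amplitude k theta0 s 0.
pose K (s : {ffun 'I_p -> 'I_N}) := wavenumber k s.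
have A0 s : inc s -> 0 < A s by exact: amplitude_gt0.
have dA0 s : dominant s -> 0 < A s by move=> /andP[/A0].
have [sa sad saK] := exists_dominant a aD erefl.
have [sb sbd sbK] := exists_dominant b bD (esym vab).
have kab := hk _ _ ab.
exists (fun xi => expsum dominant (fun s => A s * K s) (fun s => - K s) xi /
             expsum dominant A (fun s => - K s) xi); split.
- move=> xi; under eq_fun do rewrite w1_line.
  have -> : expsum dominant (fun s => A s * K s) (fun s => - K s) xi =
      \sum_(s | inc s && (rate s == top)) A s * expR (- K s * xi) * K s.
    by apply: eq_bigr => s _; rewrite mulrAC.
  apply: cvg_expsum_ratio; [|exact: rate_le|by exists sa].
  by move=> s /A0 ?; rewrite mulr_gt0 ?expR_gt0.
(* Reversing xi turns the exponents [- K] into [K]; the larger wavenumber wins, which is that of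
   [sb] as k_a < k_b. *)
- apply/cvgNy_compNP.
  have E B : (expsum dominant B (fun s => - K s)) \o -%R = expsum dominant B K.
    by apply/funext => t; apply: eq_bigr => s _; rewrite mulrNN.
  rewrite (_ : _ \o _ = fun t => expsum dominant (fun s => A s * K s) K t /
     expsum dominant A K t); last first.
    by rewrite -!E.
  apply: (cvg_expsum_ratio_cst _ _ _ _ (K sb)) => //.
  + by move=> s /dominant_wavenumber; rewrite /K sbK => -[] ->;
      rewrite ?lerD2l// ltW.
  + by exists sb; rewrite sbd eqxx.
  + by move=> s _ ->.
(* With exponents [- K] the smaller wavenumber wins, that of [sa]. *)
- apply: (cvg_expsum_ratio_cst _ _ _ _ (- K sa)) => //.
  + by move=> s /dominant_wavenumber; rewrite /K saK lerN2 => -[] ->;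
      rewrite ?lerD2l// ltW.
  + by exists sa; rewrite sad eqxx.
  + by move=> s _ /oppr_inj ->.
Qed.

End Asymptotics.

(** * Sums over zero-based ordinals as sums over integer ranges *)

Section IndexRanges.
Context {V : nmodType} (N : nat) (F : nat -> V).

Lemma sum_ord_itv m n : (n <= N)%N ->
  \sum_(x < N | (m <= x < n)%N) F x.+1 = \sum_(m <= j < n) F j.+1.
Proof.
move=> nN; rewrite (big_nat_widenl _ 0)// (big_nat_widen _ _ _ _ _ nN) big_mkord.
exact: eq_bigl.
Qed.

Lemma sum_ord_ends m n :
  (m <= n)%N -> (n <= N)%N ->
  \sum_(x < N | (x < m)%N || (n <= x)%N) F x.+1 =
  \sum_(0 <= j < m) F j.+1 + \sum_(n <= j < N) F j.+1.
Proof.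
move=> mn nN; rewrite (bigID (fun x : 'I_N => x < m)%N)/=.
rewrite -!sum_ord_itv ?(leq_trans mn)//.
by congr (_ + _); apply: eq_bigl => x; have := ltn_ord x; lia.
Qed.

(** Turns the sums counted down from N in [Kmp] and [Kpp] into ascending ranges. *)
Lemma sum_from_top q : (q <= N)%N ->
  \sum_(1 <= j < q.+1) F (N - j + 1)%N = \sum_(N - q <= j < N) F j.+1.
Proof.
elim: q => [_|q IH qN]; first by rewrite subn0 !big_geq.
rewrite big_nat_recr//= IH 1?ltnW// [RHS]big_ltn; last by lia.
by rewrite addrC addn1 -subSn// subSS.
Qed.

End IndexRanges.

(** * The concrete D, a and b for each sign of y *)

Theorem theorem2p5 (R : realType) (Np Nm : nat) (k theta0 : nat -> R)
    (hNp : (1 <= Np)%N) (hNm : (1 <= Nm)%N)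
    (hk : forall i j : nat,
        (1 <= i)%N -> (i < j)%N -> (j <= Np + Nm)%N -> k i < k j) :
  (forall i : nat, (1 <= i <= Nm)%N ->
     exists f : R -> R,
       [/\ forall xi : R,
             w1 (Np + Nm) Np k theta0 (c k i (Np + i) * y + xi) y
               @[y --> -oo] --> f xi,
           f xi @[xi --> -oo] --> Kmm k Np i
         & f xi @[xi --> +oo] --> Kpm k Np i]) /\
  (forall i : nat, (1 <= i <= Np)%N ->
     exists f : R -> R,
       [/\ forall xi : R,
             w1 (Np + Nm) Np k theta0 (c k i (Nm + i) * y + xi) y
               @[y --> +oo] --> f xi,
           f xi @[xi --> -oo] --> Kmp k (Np + Nm) Np i
         & f xi @[xi --> +oo] --> Kpp k (Np + Nm) Np i]).
Proof.
set N := (Np + Nm)%N.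
have hk' (x y : 'I_N) : (x < y)%N -> k x.+1 < k y.+1.
  by move=> xy; apply: hk; rewrite ?ltnS.
split=> i /andP[i1 iN].
- have aN : (i.-1 < N)%N by rewrite /N; lia.
  have bN : ((Np + i).-1 < N)%N by rewrite /N; lia.
  (* The ordinal x stands for the index x + 1, so D holds the indices strictly between i and N_+ +
     i. *)
  pose D := [set x : 'I_N | (i <= x < (Np + i).-1)%N]%SET.
  have ia : i.-1.+1 = i by lia.
  have ib : (Np + i).-1.+1 = (Np + i)%N by lia.
  (* Generic in V so that it also gives the cardinality of D, with F = 1. *)
  have sumD (V : nmodType) (F : nat -> V) :
      \sum_(x in D) F x.+1 = \sum_(i <= j < (Np + i).-1) F j.+1.
    by rewrite -(sum_ord_itv N)//; [apply: eq_bigl => x; rewrite inE|lia].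
  have [|||||||f [f1 f2 f3]] := w1_asymptotics (p := Np) k theta0 hk' D
    (Ordinal aN) (Ordinal bN) (-1) (c k i (Np + i)).
  + by rewrite /=; lia.
  + by rewrite inE /=; lia.
  + by rewrite inE /=; lia.
  + by rewrite /= ia ib /c; ring.
  (* Here [v x - v a] is -(k - k_i)(k - k_{N_+ + i}) at k = k_{x+1}; [nra] multiplies the two root
     inequalities. *)
  + move=> x; rewrite inE /= ia => /andP[ix xi].
    have k1 : k i < k x.+1 by apply: hk; lia.
    have k2 : k x.+1 < k (Np + i)%N by apply: hk; lia.
    by rewrite /c; nra.
  + move=> x; rewrite inE -!val_eqE /= ia => xD xa xb.
    have [xi|xi] := ltnP x i.
      have k1 : k x.+1 < k i by apply: hk; lia.
      have k2 : k x.+1 < k (Np + i)%N by apply: hk; lia.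
      by rewrite /c; nra.
    have k1 : k i < k x.+1 by apply: hk => //; have := ltn_ord x; lia.
    have k2 : k (Np + i)%N < k x.+1 by apply: hk => //; have := ltn_ord x; lia.
    by rewrite /c; nra.
  + rewrite -sum1_card (sumD nat (fun=> 1%N)) sum_nat_const_nat; lia.
  exists f; split.
  + move=> xi; apply/cvgNy_compNP.
    rewrite (_ : _ \o _ = fun t => w1 N Np k theta0
      (c k i (Np + i) * (-1 * t) + xi) (-1 * t)); first exact: f1.
    by apply/funext => t; rewrite /= (mulN1r t).
  (* Adding b appends the last index N_+ + i to the range of D; in the next case, adding a prepends
     i. *)
  + rewrite (_ : Kmm k Np i = \sum_(x in D) k x.+1 + k (Ordinal bN).+1)//.
    rewrite sumD /= /Kmm big_add1 /= -{1}ib big_nat_recr /=; first by [].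
    lia.
  + rewrite (_ : Kpm k Np i = \sum_(x in D) k x.+1 + k (Ordinal aN).+1)//.
    rewrite sumD /= ia /Kpm subn1 ib [LHS]big_ltn 1?addrC; last by lia.
    by rewrite big_add1.
- have aN : (i.-1 < N)%N by rewrite /N; lia.
  have bN : ((Nm + i).-1 < N)%N by rewrite /N; lia.
  (* In one-based terms, the indices below i or above N_- + i. *)
  pose D := [set x : 'I_N | (x < i.-1)%N || (Nm + i <= x)%N]%SET.
  have ia : i.-1.+1 = i by lia.
  have ib : (Nm + i).-1.+1 = (Nm + i)%N by lia.
  have sumD (V : nmodType) (F : nat -> V) : \sum_(x in D) F x.+1 =
      \sum_(0 <= j < i.-1) F j.+1 + \sum_(Nm + i <= j < N) F j.+1.
    by rewrite -(sum_ord_ends N)//; [apply: eq_bigl => x; rewrite inE|lia|lia].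
  have [|||||||f [f1 f2 f3]] := w1_asymptotics (p := Np) k theta0 hk' D
    (Ordinal aN) (Ordinal bN) 1 (c k i (Nm + i)).
  + by rewrite /=; lia.
  + by rewrite inE /=; lia.
  + by rewrite inE /=; lia.
  + by rewrite /= ia ib /c; ring.
  + move=> x; rewrite inE /= ia => /orP[xi|xi].
      have k1 : k x.+1 < k i by apply: hk; lia.
      have k2 : k x.+1 < k (Nm + i)%N by apply: hk; lia.
      by rewrite /c; nra.
    have k1 : k i < k x.+1 by apply: hk => //; have := ltn_ord x; lia.
    have k2 : k (Nm + i)%N < k x.+1 by apply: hk => //; have := ltn_ord x; lia.
    by rewrite /c; nra.
  + move=> x; rewrite inE -!val_eqE /= ia => xD xa xb.
    have k1 : k i < k x.+1 by apply: hk => //; have := ltn_ord x; lia.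
    have k2 : k x.+1 < k (Nm + i)%N by apply: hk => //; lia.
    by rewrite /c; nra.
  + rewrite -sum1_card (sumD nat (fun=> 1%N)) !sum_nat_const_nat; lia.
  exists f; split.
  + move=> xi.
    rewrite (_ : (fun _ => _) = fun t => w1 N Np k theta0
      (c k i (Nm + i) * (1 * t) + xi) (1 * t)); first exact: f1.
    by apply/funext => t; rewrite (mul1r t).
  + rewrite (_ : Kmp k N Np i = \sum_(x in D) k x.+1 + k (Ordinal bN).+1)//.
    rewrite sumD /= ib /Kmp subn1 addn1 sum_from_top; last by lia.
    rewrite big_add1/= -addrA; congr (_ + _).
    (* The top block of [Kmp] has one index more than that of D, namely b = N_- + i at its
       bottom. *)
    have -> : (N - (Np - i).+1 = (Nm + i).-1)%N by lia.
    by rewrite [in LHS]big_ltn ?ib 1?addrC//; lia.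
  + rewrite (_ : Kpp k N Np i = \sum_(x in D) k x.+1 + k (Ordinal aN).+1)//.
    rewrite sumD /= ia /Kpp sum_from_top; last by lia.
    (* Here the top block is that of D, and a = i extends the lower block. *)
    have -> : (N - (Np - i) = Nm + i)%N by lia.
    by rewrite big_add1/= -{1}ia big_nat_recr//= ia addrAC.
Qed.
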